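(* Let $\psi:\mathbb{R}^n\to\mathbb{C}$ be the characteristic exponent of a Lévy process in $\mathbb{R}^n$ with characteristic triplet $(b,Q,\nu)$. Denote by $$\{\psi=0\}^{[\perp]}:=\{\xi\in\mathbb{R}^n \mid \forall x\in\{\psi=0\}:\ e^{i\xi\cdot x}=1\}$$ the orthogonal subgroup of the additive group $\{\psi=0\}=\{x\in\mathbb{R}^n:\psi(x)=0\}\subset\mathbb{R}^n$. Then $$\{\psi=0\}^{[\perp]}=\overline{G_\nu+W_{\Sigma,b+c_\nu}}.$$
   Context: The characteristic exponent of a Lévy process in $\mathbb{R}^n$ has the Lévy–Khintchine representation $$\psi(\xi)=-ib\cdot\xi+\tfrac12 Q\xi\cdot\xi+\int_{\mathbb{R}^n\setminus\{0\}}\bigl(1-e^{ix\cdot\xi}+ix\cdot\xi\,\mathbf 1_{(0,1)}(|x|)\bigr)\,\nu(dx),$$ where $b\in\mathbb{R}^n$, $Q\in\mathbb{R}^{n\times n}$ is (symmetric) positive semidefinite, and $\nu$ is a Radon measure on $\mathbb{R}^n\setminus\{0\}$ with $\int\min\{|x|^2,1\}\,\nu(dx)<\infty$; $(b,Q,\nu)$ is the characteristic triplet. Notation: $\Sigma$ is the positive semidefinite square root of $Q$, and $\sigma_1,\dots,\sigma_n$ are the column vectors of $\Sigma$. $G_\nu$ is the smallest additive subgroup of $\mathbb{R}^n$ containing $\operatorname{supp}\nu$, and $\overline{G}$ denotes the closure of $G\subset\mathbb{R}^n$. $V_\nu=\{x\in\overline{G_\nu}: tx\in\overline{G_\nu}\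 \text{for all } t\in\mathbb{R}\}$, $c_\nu=-\int_{\{|y|<1\}\setminus V_\nu}y\,\nu(dy)$, and $W_{\Sigma,b+c_\nu}=\operatorname{span}\{\sigma_1,\dots,\sigma_n,b+c_\nu\}$ (linear span over $\mathbb{R}$). *)

(* Defs.v *)
From HB Require Import structures.
From mathcomp Require Import all_boot all_order all_algebra.
From mathcomp Require Import complex.
From mathcomp Require Import all_classical all_reals all_analysis.

Set Implicit Arguments.
Unset Strict Implicit.
Unset Printing Implicit Defensive.

Import Order.TTheory GRing.Theory Num.Theory.
Import numFieldNormedType.Exports.

Local Open Scope classical_set_scope.
Local Open Scope ring_scope.
Local Open Scope complex_scope.

(* R^n is 'cV[R]_n.  The library norm on matrices is the sup norm; its topology
   is the Euclidean one, but |x| in the Lévy-Khintchine formula has to be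
   [enorm]. *)
Definition dotv (R : realType) (n : nat) (x y : 'cV[R]_n) : R :=
  \sum_(i < n) x i 0 * y i 0.

Definition enorm (R : realType) (n : nat) (x : 'cV[R]_n) : R :=
  Num.sqrt (dotv x x).

Definition borelRn (R : realType) (n : nat) :=
  g_sigma_algebraType (@open 'cV[R]_n).

Definition psdmx (R : realType) (n : nat) (Q : 'M[R]_n) : Prop :=
  Q^T = Q /\ forall x : 'cV[R]_n, 0 <= dotv (Q *m x) x.

Definition psd_sqrt_of (R : realType) (n : nat) (Q S : 'M[R]_n) : Prop :=
  psdmx S /\ S *m S = Q.

(* e^(i t) *)
Definition expi (R : realType) (t : R) : R[i] := cos t +i* sin t.

Definition Cintegral (d : measure_display) (T : measurableType d) (R : realType)
    (mu : {measure set T -> \bar R}) (D : set T) (f : T -> R[i]) : R[i] :=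
  (\int[mu]_(x in D) complex.Re (f x)) +i* (\int[mu]_(x in D) complex.Im (f x)).

(* A Radon measure on R^n \ {0} is represented by its extension to the Borel
   sets of R^n that does not charge {0}.  R^n \ {0} is locally compact and
   second countable, so "Radon" is finiteness on its compact subsets. *)
Definition radon_punctured (R : realType) (n : nat)
    (nu : {measure set (borelRn R n) -> \bar R}) : Prop :=
  nu [set (0 : 'cV[R]_n)] = 0%E /\
  forall K : set 'cV[R]_n, compact K -> ~ K 0 -> (nu K < +oo)%E.

Definition levy_measure (R : realType) (n : nat)
    (nu : {measure set (borelRn R n) -> \bar R}) : Prop :=
  radon_punctured nu /\
  (\int[nu]_(x in [set~ (0%R : 'cV[R]_n)])
     (Num.min (enorm x ^+ 2) 1)%:E < +oo)%E.

Definition levy_triplet (R : realType) (n : nat) (b : 'cV[R]_n) (Q : 'M[R]_n)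
    (nu : {measure set (borelRn R n) -> \bar R}) : Prop :=
  psdmx Q /\ levy_measure nu.

Definition levy_khintchine (R : realType) (n : nat) (b : 'cV[R]_n)
    (Q : 'M[R]_n) (nu : {measure set (borelRn R n) -> \bar R})
    (xi : 'cV[R]_n) : R[i] :=
  - ('i * (dotv b xi)%:C) + (2^-1 * dotv (Q *m xi) xi)%:C
  + Cintegral nu [set~ (0%R : 'cV[R]_n)]
      (fun x => 1 - expi (dotv x xi)
        + 'i * (dotv x xi * \1_(`]0, 1[%classic : set R) (enorm x))%:C).

Definition char_exponent (R : realType) (n : nat) (b : 'cV[R]_n) (Q : 'M[R]_n)
    (nu : {measure set (borelRn R n) -> \bar R}) (psi : 'cV[R]_n -> R[i])
    : Prop :=
  levy_triplet b Q nu /\ psi = levy_khintchine b Q nu.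

(* Support of nu as a measure on R^n \ {0}. *)
Definition supp (R : realType) (n : nat)
    (nu : {measure set (borelRn R n) -> \bar R}) : set 'cV[R]_n :=
  [set x | x != 0 /\
     forall U : set 'cV[R]_n, open U -> U x -> (0 < nu U)%E].

Definition additive_subgroup (V : zmodType) (A : set V) : Prop :=
  A 0 /\ forall x y, A x -> A y -> A (x - y).

Definition Gnu (R : realType) (n : nat)
    (nu : {measure set (borelRn R n) -> \bar R}) : set 'cV[R]_n :=
  smallest (@additive_subgroup 'cV[R]_n) (supp nu).

Definition Vnu (R : realType) (n : nat)
    (nu : {measure set (borelRn R n) -> \bar R}) : set 'cV[R]_n :=
  [set x | closure (Gnu nu) x /\ forall t : R, closure (Gnu nu) (t *: x)].

(* The integral converges: closure (Gnu nu) `\` Vnu nu stays away from 0. *)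
Definition cnu (R : realType) (n : nat)
    (nu : {measure set (borelRn R n) -> \bar R}) : 'cV[R]_n :=
  \col_i - (\int[nu]_(y in [set y : 'cV[R]_n | enorm y < 1] `\` Vnu nu) y i 0).

Definition Wspan (R : realType) (n : nat) (Sigma : 'M[R]_n) (v : 'cV[R]_n)
    : set 'cV[R]_n :=
  [set x | x \in <<rcons [seq col j Sigma | j : 'I_n] v>>%VS].

Definition zero_set (R : realType) (n : nat) (psi : 'cV[R]_n -> R[i])
    : set 'cV[R]_n := [set x | psi x = 0].

Definition orth_subgroup (R : realType) (n : nat) (A : set 'cV[R]_n)
    : set 'cV[R]_n :=
  [set xi | forall x, A x -> expi (dotv xi x) = 1].

Definition set_add (V : zmodType) (A B : set V) : set V :=
  [set x + y | x in A & y in B].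

(* Main.v *)
Require Import Defs.
From HB Require Import structures.
From mathcomp Require Import all_boot all_order all_algebra.
From mathcomp Require Import complex.
From mathcomp Require Import all_classical all_reals all_analysis.
From mathcomp Require Import measurable_realfun.
From mathcomp Require Import zify ring lra.

Set Implicit Arguments.
Unset Strict Implicit.
Unset Printing Implicit Defensive.

Import Order.TTheory GRing.Theory Num.Theory.
Import numFieldNormedType.Exports.
Local Open Scope classical_set_scope.
Local Open Scope ring_scope.

(** Write [K] for the zero set of the exponent.  The real part of [psi xi] is
    [Q xi . xi / 2] plus the integral of [1 - cos (x . xi)], a sum of
    nonnegative terms.  It vanishes exactly when [Sigma xi = 0] and
    [cos (x . xi) = 1] on the support of [nu], that is, when the character
    [x |-> e^(i x . xi)] is trivial on [closure (Gnu nu)].  For such [xi] the sine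
    term of the imaginary part is zero almost everywhere, and so is the
    contribution of [Vnu nu], which contains the line of each of its points and
    on which [x . xi] is therefore 0.  What remains is linear in [xi]: the
    imaginary part is [- (b + cnu nu) . xi].  Hence [K] consists of the [xi]
    whose character is trivial on [Gnu nu + W] ([levy_khintchine_eq0],
    [Wspan_orthogonal]).

    The corollary is then the duality theorem for subgroups of [R^n]: the points
    at which all characters trivial on a subgroup are trivial form its closure.
    The inclusion that is not formal is [closed_subgroup_separation]: a point
    outside a closed subgroup [H] is separated from [H] by a character.  If [H]
    contains a line, the orthogonal projection off that line reduces the
    dimension.  If it contains none, [H] is discrete, by compactness of the
    sphere ([closed_no_line_discrete]), and one projects along an almost shortest
    vector [d] of [H] instead: the image is again discrete.  To lift a character
    back one has to control its values on the preimages, so the induction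
    extends an arbitrary homomorphism [H -> R/Z], not only the trivial one, to a
    linear form while avoiding a prescribed value at the given point
    ([discrete_extend_int_hom]).

    Splitting off lines also shows that the points of [closure (Gnu nu)] outside
    [Vnu nu] keep away from 0 ([closed_subgroup_near0]), which makes the integral
    defining [cnu nu] converge.  The support carries [nu] because [R^n] is second
    countable ([supp_conegligible]). *)

(** * Dot product and projection off a vector *)

Section dot_product.
Context {R : realType} {n : nat}.
Implicit Types (x y z d : 'cV[R]_n) (a : R).

Lemma dotvC x y : dotv x y = dotv y x.
Proof. by apply: eq_bigr => i _; rewrite mulrC. Qed.

Lemma dotvDl x y z : dotv (x + y) z = dotv x z + dotv y z.
Proof. by rewrite -big_split; apply: eq_bigr => i _; rewrite mxE mulrDl. Qed.

Lemma dotvZl a x z : dotv (a *: x) z = a * dotv x z.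
Proof. by rewrite mulr_sumr; apply: eq_bigr => i _; rewrite mxE mulrA. Qed.

Lemma dotvNl x z : dotv (- x) z = - dotv x z.
Proof. by rewrite -scaleN1r dotvZl mulN1r. Qed.

Lemma dotvBl x y z : dotv (x - y) z = dotv x z - dotv y z.
Proof. by rewrite dotvDl dotvNl. Qed.

Lemma dotvDr x y z : dotv x (y + z) = dotv x y + dotv x z.
Proof. by rewrite dotvC dotvDl !(dotvC x). Qed.

Lemma dotvZr a x z : dotv x (a *: z) = a * dotv x z.
Proof. by rewrite dotvC dotvZl dotvC. Qed.

Lemma dotvBr x y z : dotv x (y - z) = dotv x y - dotv x z.
Proof. by rewrite dotvC dotvBl !(dotvC x). Qed.

Lemma dotv0l x : dotv 0 x = 0.
Proof. by rewrite -(scale0r 0) dotvZl mul0r. Qed.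

Lemma dotv0r x : dotv x 0 = 0.
Proof. by rewrite dotvC dotv0l. Qed.

Lemma dotvE x y : dotv x y = (x^T *m y) 0 0.
Proof. by rewrite mxE; apply: eq_bigr => i _; rewrite mxE. Qed.

Lemma dotv_mulmxl (A : 'M[R]_n) x y : dotv (A *m x) y = dotv x (A^T *m y).
Proof. by rewrite !dotvE trmx_mul mulmxA. Qed.

Lemma dotvv_ge0 x : 0 <= dotv x x.
Proof. by apply: sumr_ge0 => i _; rewrite -expr2 sqr_ge0. Qed.

Lemma sqr_coord_le_dotvv x i : x i 0 ^+ 2 <= dotv x x.
Proof.
rewrite /dotv (bigD1 i)//= -expr2 lerDl.
by apply: sumr_ge0 => j _; rewrite -expr2 sqr_ge0.
Qed.

Lemma dotvv_eq0 x : (dotv x x == 0) = (x == 0).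
Proof.
apply/eqP/eqP => [x0|->]; last exact: dotv0l.
apply/colP => i; rewrite [RHS]mxE; apply/eqP.
by have := sqr_coord_le_dotvv x i; rewrite x0 -sqrf_eq0 eq_le sqr_ge0 andbT.
Qed.

Lemma dotvv_gt0 x : (0 < dotv x x) = (x != 0).
Proof. by rewrite lt_def dotvv_eq0 dotvv_ge0 andbT. Qed.

Lemma sqr_dotv_le x y : dotv x y ^+ 2 <= dotv x x * dotv y y.
Proof.
have [->|y0] := eqVneq y 0; first by rewrite !dotv0r expr0n mulr0.
have yy : 0 < dotv y y by rewrite dotvv_gt0.
have := dotvv_ge0 (dotv y y *: x - dotv x y *: y).
rewrite !(dotvBl, dotvBr, dotvZl, dotvZr) (dotvC y x) => h.
suff : 0 <= dotv y y * (dotv x x * dotv y y - dotv x y ^+ 2).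
  by rewrite pmulr_rge0// subr_ge0.
by apply: le_trans h _; rewrite le_eqVlt; apply/orP; left; apply/eqP; ring.
Qed.

Definition along d z : R := dotv z d / dotv d d.

Definition perp d z : 'cV[R]_n := z - along d z *: d.

Definition perp_mx d : 'M[R]_n := 1%:M - (dotv d d)^-1 *: (d *m d^T).

Lemma perpE d z : perp d z = perp_mx d *m z.
Proof.
rewrite /perp_mx mulmxBl mul1mx; congr (_ - _).
rewrite -scalemxAl -mulmxA (mx11_scalar (d^T *m z)) -dotvE mul_mx_scalar.
by rewrite scalerA /along dotvC mulrC.
Qed.

Lemma perp_split d z : z = perp d z + along d z *: d.
Proof. by rewrite subrK. Qed.

Lemma perpB d x y : perp d (x - y) = perp d x - perp d y.
Proof. by rewrite !perpE mulmxBr. Qed.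

Lemma perp0 d : perp d 0 = 0.
Proof. by rewrite perpE mulmx0. Qed.

Lemma alongB d x y : along d (x - y) = along d x - along d y.
Proof. by rewrite /along dotvBl mulrBl. Qed.

Lemma alongZ d a x : along d (a *: x) = a * along d x.
Proof. by rewrite /along dotvZl mulrA. Qed.

Lemma along_self d : d != 0 -> along d d = 1.
Proof. by move=> d0; rewrite /along divff// dotvv_eq0. Qed.

Lemma perp_self d : perp d d = 0.
Proof.
have [->|d0] := eqVneq d 0; first exact: perp0.
by rewrite /perp along_self// scale1r subrr.
Qed.

Lemma perpZ_self d a : perp d (a *: d) = 0.
Proof. by rewrite perpE -scalemxAr -perpE perp_self scaler0. Qed.

Lemma dotv_perp_self d z : dotv (perp d z) d = 0.
Proof.
have [->|d0] := eqVneq d 0; first exact: dotv0r.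
by rewrite dotvBl dotvZl /along divfK ?subrr// dotvv_eq0.
Qed.

Lemma dotv_perpC d x z : dotv (perp d x) z = dotv x (perp d z).
Proof.
rewrite dotvBl dotvBr dotvZl dotvZr /along (dotvC d z).
ring.
Qed.

Lemma perp_id d z : dotv z d = 0 -> perp d z = z.
Proof. by move=> zd; rewrite /perp /along zd mul0r scale0r subr0. Qed.

Lemma dotvv_perp d z :
  dotv z z = dotv (perp d z) (perp d z) + along d z ^+ 2 * dotv d d.
Proof.
have := dotv_perp_self d z; rewrite {2 3}(perp_split d z).
move: (perp d z) (along d z) => p a pd.
by rewrite !(dotvDl, dotvDr, dotvZl, dotvZr) (dotvC d p) pd; ring.
Qed.

Lemma dotvv_perp_le d z : dotv (perp d z) (perp d z) <= dotv z z.
Proof.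
by rewrite (dotvv_perp d z) lerDl mulr_ge0 ?sqr_ge0// dotvv_ge0.
Qed.

(** Subspaces are encoded as row spaces; projecting off a vector [d] of the
    subspace lowers the dimension, which is what the inductions below use. *)
Lemma rank_perp (U : 'M[R]_n) d : d != 0 -> (d^T <= U)%MS ->
  (\rank (U *m (perp_mx d)^T) < \rank U)%N.
Proof.
move=> d0 dU; rewrite -(mxrank_mul_ker U (perp_mx d)^T) -addn1 leq_add2l.
rewrite lt0n mxrank_eq0; apply/eqP => cap0.
have : (d^T <= U :&: kermx (perp_mx d)^T)%MS.
  rewrite sub_capmx dU; apply/sub_kermxP.
  by rewrite -trmx_mul -perpE perp_self trmx0.
by rewrite cap0 submx0 -trmx0 (inj_eq trmx_inj) (negPf d0).
Qed.

Lemma sub_perp (U : 'M[R]_n) d z :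
  (z^T <= U)%MS -> ((perp d z)^T <= U *m (perp_mx d)^T)%MS.
Proof. by move=> zU; rewrite perpE trmx_mul submxMr. Qed.

End dot_product.

(** * Additive subgroups *)

Section additive_subgroups.
Context {V : zmodType} (H : set V).
Hypothesis Hsub : additive_subgroup H.

Lemma subgroup0 : H 0.
Proof. by case: Hsub. Qed.

Lemma subgroupB x y : H x -> H y -> H (x - y).
Proof. by case: Hsub => _; exact. Qed.

Lemma subgroupN x : H x -> H (- x).
Proof. by move=> Hx; rewrite -sub0r; apply: subgroupB => //; case: Hsub. Qed.

Lemma subgroupD x y : H x -> H y -> H (x + y).
Proof. by move=> Hx Hy; rewrite -[y]opprK; apply/subgroupB/subgroupN. Qed.

Lemma subgroupMz x (k : int) : H x -> H (x *~ k).
Proof.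
move=> Hx; have Hn m : H (x *+ m).
  elim: m => [|m IH]; first by rewrite mulr0n; exact: subgroup0.
  by rewrite mulrS; exact: subgroupD.
case: k => m; first by rewrite -pmulrn.
by rewrite NegzE mulrNz -pmulrn; apply: subgroupN.
Qed.

End additive_subgroups.

(** * Characters of discrete subgroups *)

Section discrete_subgroups.
Context {R : realType} {n : nat}.
Implicit Types (x y z d : 'cV[R]_n) (H : set 'cV[R]_n).

(** A homomorphism [H -> R/Z], given by real representatives of its values. *)
Definition int_hom_on H (chi : 'cV[R]_n -> R) : Prop :=
  forall x y, H x -> H y -> chi (x - y) - (chi x - chi y) \is a Num.int.

Lemma int_hom0 H chi : H 0 -> int_hom_on H chi -> chi 0 \is a Num.int.
Proof. by move=> H0 /(_ _ _ H0 H0); rewrite !subrr subr0. Qed.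

Lemma int_homN H chi x : additive_subgroup H -> int_hom_on H chi ->
  H x -> chi (- x) + chi x \is a Num.int.
Proof.
move=> Hsub chiH Hx; have H0 := subgroup0 Hsub.
have := rpredD (chiH _ _ H0 Hx) (int_hom0 H0 chiH).
by rewrite sub0r; congr (_ \is a Num.int); ring.
Qed.

Lemma int_homD H chi x y : additive_subgroup H -> int_hom_on H chi ->
  H x -> H y -> chi (x + y) - (chi x + chi y) \is a Num.int.
Proof.
move=> Hsub chiH Hx Hy; have := chiH _ _ (subgroupD Hsub Hx Hy) Hy.
by rewrite addrK -rpredN; congr (_ \is a Num.int); ring.
Qed.

Lemma int_homMz H chi x (k : int) : additive_subgroup H -> int_hom_on H chi ->
  H x -> chi (x *~ k) - chi x *~ k \is a Num.int.
Proof.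
move=> Hsub chiH Hx.
have chiMn m : chi (x *+ m) - chi x *+ m \is a Num.int.
  elim: m => [|m IH].
    by rewrite !mulr0n subr0; exact: int_hom0 (subgroup0 Hsub) chiH.
  have Hm : H (x *+ m) by rewrite pmulrn; exact: subgroupMz.
  have := rpredD (int_homD Hsub chiH Hx Hm) IH.
  by rewrite !mulrS; congr (_ \is a Num.int); ring.
case: k => m; first by rewrite -!pmulrn; exact: chiMn.
rewrite NegzE !mulrNz -!pmulrn opprK.
have Hm : H (x *+ m.+1) by rewrite pmulrn; exact: subgroupMz.
have := rpredB (int_homN Hsub chiH Hm) (chiMn m.+1).
by congr (_ \is a Num.int); ring.
Qed.

(** The bound [r] is on squared lengths, which avoids square roots. *)
Definition discrete_by (r : R) H := forall h, H h -> h != 0 -> r <= dotv h h.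

(** A vector of length less than [sqrt 2] times the infimum is short enough for
    projections, so no minimum has to be attained. *)
Lemma exists_short_vector H r : 0 < r -> discrete_by r H ->
  (exists2 h, H h & h != 0) ->
  exists d, [/\ H d, d != 0 & exists2 m, dotv d d < 2 * m & discrete_by m H].
Proof.
move=> r0 Hr [h0 Hh0 h00].
pose S := [set dotv h h | h in [set h | H h /\ h != 0]].
have Sinf : has_inf S.
  split; first by exists (dotv h0 h0); exists h0.
  by exists r => _ [h [Hh hn0] <-]; exact: Hr.
have rS : r <= inf S.
  apply: lb_le_inf; first by case: Sinf.
  by move=> _ [h [Hh hn0] <-]; exact: Hr.
have [_ [d [Hd d0] <-] dS] := inf_adherent (lt_le_trans r0 rS) Sinf.
exists d; split=> //; exists (inf S); first by rewrite mulr_natl mulr2n.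
by move=> h Hh hn0; apply: ge_inf; [case: Sinf|exists h].
Qed.

Section projection_along_short_vector.
Variables (H : set 'cV[R]_n) (d : 'cV[R]_n) (m : R).
Hypotheses (Hsub : additive_subgroup H) (Hd : H d) (d0 : d != 0).
Hypotheses (dm : dotv d d < 2 * m) (Hm : discrete_by m H).

Lemma subgroup_perp : additive_subgroup (perp d @` H).
Proof.
split; first by exists 0; [exact: subgroup0|exact: perp0].
move=> _ _ [x Hx <-] [y Hy <-]; exists (x - y); last exact: perpB.
exact: subgroupB.
Qed.

(** Subtract from [h] the nearest multiple of [d]. *)
Lemma centered_lift h : H h -> exists h', [/\ H h', perp d h' = perp d h,
  along d h' ^+ 2 <= 4^-1 & exists k : int, h = h' + k%:~R *: d].
Proof.
move=> Hh; pose k : int := Num.floor (along d h + 2^-1).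
exists (h - k%:~R *: d); split.
- by rewrite scaler_int; apply: subgroupB => //; exact: subgroupMz.
- by rewrite perpB perpZ_self subr0.
- rewrite alongB alongZ along_self// mulr1.
  have /andP[k1 k2] := floor_itv (along d h + 2^-1).
  rewrite -/k in k1 k2; rewrite intrD in k2.
  have e1 : 0 <= 2^-1 - (along d h - k%:~R) by lra.
  have e2 : 0 <= 2^-1 + (along d h - k%:~R) by lra.
  by have := mulr_ge0 e1 e2; rewrite expr2; lra.
- by exists k; rewrite subrK.
Qed.

(** The squared length of a centered lift exceeds that of the projected point by
    at most [|d|^2 / 4 < m / 2], and the lift cannot be short. *)
Lemma discrete_perp : discrete_by (m / 2) (perp d @` H).
Proof.
move=> _ [h Hh <-] ph0.
have [h' [Hh' ph' ah' _]] := centered_lift Hh.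
rewrite -ph' in ph0 *.
have h'0 : h' != 0 by apply: contraNneq ph0 => ->; rewrite perp0.
have := Hm Hh' h'0; rewrite (dotvv_perp d h').
have := ler_wpM2r (dotvv_ge0 d) ah'; move: dm; lra.
Qed.

Lemma perp_kernel h : H h -> perp d h = 0 -> along d h \is a Num.int.
Proof.
move=> Hh ph0; have [h' [Hh' ph' ah' [k hk]]] := centered_lift Hh.
suff h'0 : h' = 0.
  rewrite hk h'0 add0r alongZ along_self// mulr1.
  exact: intr_int.
apply/eqP; apply: contraT => /(Hm Hh').
rewrite (dotvv_perp d h') ph' ph0 dotv0l add0r.
have := ler_wpM2r (dotvv_ge0 d) ah'; move: dm (dotvv_ge0 d); lra.
Qed.

End projection_along_short_vector.

Lemma half_not_int : (2^-1 : R) \isn't a Num.int.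
Proof.
apply/negP => /intrP[j jE].
have : (1 : int)%:~R = (j * 2)%:~R :> R by rewrite intrM -jE mulVf.
by move=> /eqP; rewrite eqr_int => /eqP; lia.
Qed.

Lemma trivial_extend_int_hom H chi x (c : R) :
  additive_subgroup H -> (forall h, H h -> h = 0) -> int_hom_on H chi ->
  ~ H x ->
  exists2 xi, (forall h, H h -> dotv xi h - chi h \is a Num.int)
            & dotv xi x - c \isn't a Num.int.
Proof.
move=> Hsub HE chiH Hx.
have x0 : x != 0 by apply/eqP => x0; apply: Hx; rewrite x0; exact: subgroup0.
exists (((c + 2^-1) / dotv x x) *: x).
  move=> h /HE ->; rewrite dotv0r sub0r rpredN.
  exact: int_hom0 (subgroup0 Hsub) chiH.
rewrite dotvZl divfK ?dotvv_eq0// addrAC subrr add0r.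
exact: half_not_int.
Qed.

(** Project [H] along a short vector [d].  A choice of slope [a] along [d],
    congruent to [chi d], turns [chi] into a homomorphism on the projection
    (subtract [a] times the coordinate along [d] of any lift), to which the
    induction hypothesis applies.  If the projection of [x] misses that of [H],
    the induction hypothesis also avoids [c]; otherwise [x] lies over a point of
    the projection and two choices of [a] give values that differ at [x]. *)
Lemma discrete_extend_int_hom (k : nat) (U : 'M[R]_n) H chi x (c r : R) :
  (\rank U < k)%N -> (forall h, H h -> (h^T <= U)%MS) ->
  additive_subgroup H -> 0 < r -> discrete_by r H -> int_hom_on H chi ->
  ~ H x ->
  exists2 xi, (forall h, H h -> dotv xi h - chi h \is a Num.int)
            & dotv xi x - c \isn't a Num.int.
Proof.
elim: k U H chi x c r => [//|k IH] U H chi x c r rkU HU Hsub r0 Hr chiH Hx.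
have [/(exists_short_vector r0 Hr)[d [Hd d0 [m dm Hm]]]|Htriv] :=
    pselect (exists2 h, H h & h != 0); last first.
  apply: trivial_extend_int_hom => // h Hh.
  by apply/eqP/negP => /negP h0; apply: Htriv; exists h.
have m0 : 0 < m.
  by have dd : 0 < dotv d d by [rewrite dotvv_gt0]; move: dm dd; lra.
pose U' := U *m (perp_mx d)^T.
have rkU' : (\rank U' < k)%N by apply: leq_trans (rank_perp d0 (HU _ Hd)) _.
pose H' := perp d @` H.
have H'U' y : H' y -> (y^T <= U')%MS by move=> [h Hh <-]; exact/sub_perp/HU.
have H'sub : additive_subgroup H' by exact: subgroup_perp.
have m20 : 0 < m / 2 by rewrite divr_gt0.
have H'disc : discrete_by (m / 2) H' by exact: discrete_perp.
have [lift liftP] : {f : 'cV[R]_n -> 'cV[R]_n &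
    forall y, H' y -> H (f y) /\ perp d (f y) = y}.
  apply: (@choice _ _ (fun y h => H' y -> H h /\ perp d h = y)) => y.
  by have [[h Hh <-]|] := pselect (H' y); [exists h|exists 0].
have along_lift h h' : H h -> H h' -> perp d h = perp d h' ->
    along d h - along d h' \is a Num.int.
  move=> Hh Hh' ph; rewrite -alongB; apply: (perp_kernel Hsub Hd d0 dm Hm).
    exact: subgroupB.
  by rewrite perpB ph subrr.
(* Two lifts of the same point differ by an integer multiple of [d]. *)
have chi_lift h h' : H h -> H h' -> perp d h = perp d h' ->
    chi h - chi h' - (along d h - along d h') * chi d \is a Num.int.
  move=> Hh Hh' ph; have /intrP[j aj] := along_lift _ _ Hh Hh' ph.
  have hE : h - h' = d *~ j.
    rewrite (perp_split d (h - h')) perpB ph subrr add0r alongB aj.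
    exact: scaler_int.
  have := rpredB (int_homMz j Hsub chiH Hd) (chiH _ _ Hh Hh').
  by rewrite hE aj -mulrzl; congr (_ \is a Num.int); ring.
have step a x' c' : a - chi d \is a Num.int -> ~ H' x' ->
    exists xi xi', [/\ forall h, H h -> dotv xi h - chi h \is a Num.int,
      forall z, dotv xi z = dotv xi' (perp d z) + a * along d z
    & dotv xi' x' - c' \isn't a Num.int].
  move=> ad Hx'; pose chi' y := chi (lift y) - a * along d (lift y).
  have chi'H : int_hom_on H' chi'.
    move=> y z Hy Hz; rewrite /chi'.
    have [Hly ply] := liftP _ Hy; have [Hlz plz] := liftP _ Hz.
    have [Hl pl] := liftP _ (subgroupB H'sub Hy Hz).
    have Hlyz := subgroupB Hsub Hly Hlz.
    have pe : perp d (lift (y - z)) = perp d (lift y - lift z).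
      by rewrite pl perpB ply plz.
    have := rpredB (rpredD (chi_lift _ _ Hl Hlyz pe) (chiH _ _ Hly Hlz))
      (rpredM (along_lift _ _ Hl Hlyz pe) ad).
    by rewrite alongB; congr (_ \is a Num.int); ring.
  have [xi' xi'H xi'x'] :=
    IH U' H' chi' x' c' _ rkU' H'U' H'sub m20 H'disc chi'H Hx'.
  pose xi := perp d xi' + (a / dotv d d) *: d.
  have xiE z : dotv xi z = dotv xi' (perp d z) + a * along d z.
    by rewrite dotvDl dotv_perpC dotvZl (dotvC d z) /along; ring.
  exists xi, xi'; split=> // h Hh; rewrite xiE.
  have Hph : H' (perp d h) by exists h.
  have [Hl pl] := liftP _ Hph.
  have := rpredB (rpredD (xi'H _ Hph) (chi_lift _ _ Hl Hh pl))
      (rpredM (along_lift _ _ Hl Hh pl) ad).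
  by rewrite /chi'; congr (_ \is a Num.int); ring.
have [[h Hh ph]|Hpx] := pselect (H' (perp d x)); last first.
  have chid : chi d - chi d \is a Num.int by rewrite subrr.
  have [xi [xi' [xiH xiE xix]]] := step _ _ (c - chi d * along d x) chid Hpx.
  exists xi => //; rewrite xiE; move: xix; apply: contraNN.
  by congr (_ \is a Num.int); ring.
(* Now [x] lies over a point of the projected group.  Its offset [s] along [d]
   from that group is not an integer, so one of the slopes [chi d] and
   [chi d + 1] works.  The vector [d], orthogonal to the projection, serves as a
   dummy point outside it for the induction hypothesis. *)
have Hd' : ~ H' d.
  move=> [y _ yd]; have := dotv_perp_self d y.
  by rewrite yd => /eqP; rewrite dotvv_eq0 (negPf d0).
pose s := along d x - along d h.
have xE : x = h + s *: d.
  rewrite {1}(perp_split d x) -ph /perp /s scalerBl -addrA.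
  by rewrite (addrC (- _)).
have sNint : s \isn't a Num.int.
  apply/negP => /intrP[j sj]; apply: Hx.
  by rewrite xE sj scaler_int; apply: subgroupD => //; exact: subgroupMz.
have [a ad ac] : exists2 a, a - chi d \is a Num.int &
    chi h + a * s - c \isn't a Num.int.
  have [i1|] := boolP (chi h + chi d * s - c \is a Num.int); last first.
    by exists (chi d) => //; rewrite subrr.
  exists (chi d + 1); first by rewrite addrAC subrr add0r.
  apply: contra sNint => i2; have := rpredB i2 i1.
  by congr (_ \is a Num.int); ring.
have [xi [xi' [xiH xiE _]]] := step a d 0 ad Hd'.
exists xi => //; apply: contra ac => i1; have := rpredB i1 (xiH _ Hh).
rewrite !xiE -ph /s; congr (_ \is a Num.int); ring.
Qed.

End discrete_subgroups.

(** * Closed subgroups *)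

Section topology.
Context {R : realType} {n : nat}.
Implicit Types (x y z d u : 'cV[R]_n) (H : set 'cV[R]_n).

Lemma mx_norm_leP (p q : nat) (A : 'M[R]_(p, q)) (e : R) :
  0 <= e -> `|A| <= e <-> forall i j, `|A i j| <= e.
Proof.
move=> e0; rewrite [`|A|]mx_normrE; split=> [h i j|h].
  by apply: le_trans h; rewrite -[leLHS]/((fun ij => `|A ij.1 ij.2|) (i, j));
     exact: le_bigmax.
by apply: bigmax_le => // ij _; exact: h.
Qed.

Lemma norm_trmx_le (p q : nat) (A : 'M[R]_(p, q)) : `|A^T| <= `|A|.
Proof.
apply/mx_norm_leP => // i j; rewrite mxE.
by move: j i; apply/mx_norm_leP.
Qed.

Lemma norm_le_enorm x : `|x| <= enorm x.
Proof.
apply/mx_norm_leP; first exact: sqrtr_ge0.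
move=> i j; rewrite (ord1 j) -sqrtr_sqr ler_wsqrtr//; exact: sqr_coord_le_dotvv.
Qed.

Lemma trmx_continuous (p q : nat) : continuous (@trmx R p q).
Proof.
move=> A B /nbhs_ballP[e e0 eB]; apply/nbhs_ballP; exists e => // C [_ AC].
by apply: eB; split=> // i j; rewrite !mxE; exact: AC.
Qed.

Lemma dotvl_continuous z : continuous (fun x : 'cV[R]_n => dotv x z).
Proof.
move=> x; apply: (@cvg_big _ _ _ _ _ add_continuous _ (nbhs x)) => i _.
apply: (@cvgM _ _ (nbhs x)); last exact: cvg_cst.
exact: coord_continuous.
Qed.

Lemma dotvv_continuous : continuous (fun x : 'cV[R]_n => dotv x x).
Proof.
move=> x; apply: (@cvg_big _ _ _ _ _ add_continuous _ (nbhs x)) => i _.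
by apply: (@cvgM _ _ (nbhs x)); exact: coord_continuous.
Qed.

Lemma compact_sphere : compact [set u : 'cV[R]_n | dotv u u = 1].
Proof.
pose S := [set v : 'rV[R]_n | dotv v^T v^T = 1].
have cS : compact S.
  apply: bounded_closed_compact.
    exists 1; split=> // M M1 v vS.
    apply: le_trans (ltW M1); rewrite -[v]trmxK.
    apply: le_trans (norm_trmx_le _) _; apply: le_trans (norm_le_enorm _) _.
    by rewrite /enorm vS sqrtr1.
  apply: ((continuous_closedP (fun v : 'rV[R]_n => dotv v^T v^T)).1 _ [set 1]);
    last exact: closed_eq.
  move=> v; apply: (@continuous_comp _ _ _ trmx (fun x => dotv x x)).
    exact: trmx_continuous.
  exact: dotvv_continuous.
have -> : [set u : 'cV[R]_n | dotv u u = 1] = trmx @` S.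
  apply/seteqP; split=> [u u1|_ [v vS <-]//].
  by exists u^T; rewrite ?trmxK //= /S /= trmxK.
apply: continuous_compact => //.
apply: continuous_subspaceT; exact: trmx_continuous.
Qed.

Definition has_line H u := forall t : R, H (t *: u).

(** Nonzero points of [H] tending to 0 have directions accumulating at some [u]
    on the sphere.  Suitable integer multiples of these points approximate every
    [t *: u], so [H] would contain the line of [u]. *)
Lemma closed_no_line_discrete H : closed H -> additive_subgroup H ->
  (forall u, has_line H u -> u = 0) -> exists2 r, 0 < r & discrete_by r H.
Proof.
move=> cH Hsub noline; apply: contrapT => /forall2NP nodisc.
have short (k : nat) : exists h, [/\ H h, h != 0 & enorm h < k.+1%:R^-1].
  have [[]|/existsNP[h /not_implyP[Hh /not_implyP[h0 /negP]]]] :=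
    nodisc (k.+1%:R^-1 ^+ 2).
    by rewrite exprn_gt0// invr_gt0.
  rewrite -ltNge => hk; exists h; split=> //.
  by rewrite -[ltRHS]ger0_norm// -sqrtr_sqr ltr_sqrt// exprn_gt0.
have [h hP] := choice short.
pose v k := (enorm (h k))^-1 *: h k.
have s0 k : 0 < enorm (h k).
  by have [_ h0 _] := hP k; rewrite sqrtr_gt0 dotvv_gt0.
have hE k : h k = enorm (h k) *: v k.
  by rewrite scalerA divff ?scale1r// gt_eqF.
have v1 k : dotv (v k) (v k) = 1.
  rewrite dotvZl dotvZr mulrA -expr2 -[dotv (h k) (h k)]sqr_sqrtr ?dotvv_ge0//.
  by rewrite -exprMn mulVf ?expr1n// gt_eqF.
have [u [u1 cu]] : [set u | dotv u u = 1] `&` cluster (v @ \oo) !=set0.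
  apply: compact_sphere; exists 0%N => // k _; exact: v1.
suff : has_line H u.
  move=> /noline u0; have := u1; rewrite /= u0 dotv0l => /esym/eqP.
  by rewrite oner_eq0.
move=> t; rewrite ((closure_id H).1 cH) => B /nbhs_ballP[e /= e0 eB].
have e20 : 0 < e / 2 by rewrite divr_gt0.
have t1 : 0 < `|t| + 1 by rewrite ltr_wpDl.
pose A := v @` [set k | k.+1%:R^-1 < e / 2].
have [] := cu A (ball u (e / 2 / (`|t| + 1))).
- apply: filterS (near_infty_natSinv_lt (PosNum e20)) => k ke.
  by exists k.
- by apply: nbhsx_ballx; rewrite divr_gt0.
move=> _ [[k /= ke <-]]; rewrite -ball_normE /= => uv.
have [Hh _ hk] := hP k.
pose m : int := Num.floor (t / enorm (h k)).
exists (h k *~ m); split; first exact: subgroupMz.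
apply: eB; rewrite -ball_normE /=.
(* [m] is chosen so that [t - m |h k|] lies between 0 and [|h k|] *)
have -> : t *: u - h k *~ m =
    t *: (u - v k) + (t - m%:~R * enorm (h k)) *: v k.
  rewrite -scaler_int [in LHS]hE scalerA scalerBr scalerBl.
  by rewrite addrA subrK.
have vk : `|v k| <= 1.
  by apply: le_trans (norm_le_enorm _) _; rewrite /enorm v1 sqrtr1.
rewrite [e]splitr; apply: le_lt_trans (ler_normD _ _) _; apply: ltrD.
  rewrite normrZ; apply: le_lt_trans (_ : _ <= (`|t| + 1) * `|u - v k|) _.
    by rewrite ler_wpM2r// lerDl.
  by rewrite mulrC -ltr_pdivlMr.
rewrite normrZ; apply: le_lt_trans (ler_piMr _ vk) _ => //.
apply: lt_trans (lt_trans hk ke).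
have /andP[m1 m2] := floor_itv (t / enorm (h k)); rewrite -/m in m1 m2.
rewrite ler_pdivlMr// in m1; rewrite ltr_pdivrMr// intrD mulrDl mul1r in m2.
by rewrite ger0_norm ?subr_ge0// ltrBlDl.
Qed.

Lemma perp_line_subgroup H d : additive_subgroup H -> has_line H d ->
  perp d @` H = H `&` [set z | dotv z d = 0].
Proof.
move=> Hsub dH; apply/seteqP; split=> [_ [h Hh <-]|h [Hh hd]].
  split; last exact: dotv_perp_self.
  by apply: subgroupB => //; exact: dH.
by exists h => //; exact: perp_id.
Qed.

Lemma closed_perp H d : closed H -> additive_subgroup H -> has_line H d ->
  closed (perp d @` H).
Proof.
move=> cH Hsub dH; rewrite perp_line_subgroup//; apply: closedI => //.
apply: ((continuous_closedP _).1 (dotvl_continuous (z := d)) [set 0]).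
exact: closed_eq.
Qed.

(** The structure theorem for closed subgroups as an induction principle: each
    line split off lowers the dimension, and what has no line is discrete. *)
Lemma closed_subgroup_ind (P : set 'cV[R]_n -> Prop) :
  (forall H r, additive_subgroup H -> 0 < r -> discrete_by r H -> P H) ->
  (forall H d, additive_subgroup H -> d != 0 -> has_line H d ->
    P (perp d @` H) -> P H) ->
  forall H, closed H -> additive_subgroup H -> P H.
Proof.
move=> Pdisc Pline H cH Hsub.
have [k] := ubnP (\rank (1%:M : 'M[R]_n)).
have HU h : H h -> (h^T <= (1%:M : 'M[R]_n))%MS by move=> _; exact: submx1.
move: 1%:M HU => U; elim: k U H cH Hsub => [//|k IH] U H cH Hsub HU rkU.
have [[d dH d0]|noline] := pselect (exists2 d, has_line H d & d != 0);
    last first.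
  have [|r r0 Hr] := closed_no_line_discrete cH Hsub; last exact: Pdisc Hr.
  by move=> u uH; apply/eqP/negP => /negP u0; apply: noline; exists u.
have Hd : H d by rewrite -[d]scale1r; exact: dH.
apply: (Pline _ d) => //; apply: (IH (U *m (perp_mx d)^T)).
- exact: closed_perp.
- exact: subgroup_perp.
- by move=> _ [h Hh <-]; exact/sub_perp/HU.
- by apply: leq_trans (rank_perp d0 (HU _ Hd)) _.
Qed.

Lemma mem_perp_line H d z : additive_subgroup H -> has_line H d ->
  (perp d @` H) (perp d z) -> H z.
Proof.
move=> Hsub dH; rewrite perp_line_subgroup// => -[Hpz _].
by rewrite (perp_split d z); apply: subgroupD => //; exact: dH.
Qed.

(** The separating character is [y |-> e^(2 i pi xi . y)]. *)
Lemma closed_subgroup_separation H x :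
  closed H -> additive_subgroup H -> ~ H x ->
  exists2 xi, (forall h, H h -> dotv xi h \is a Num.int)
            & dotv xi x \isn't a Num.int.
Proof.
move=> cH Hsub; move: H cH Hsub x.
apply: closed_subgroup_ind => [H r Hsub r0 Hr x Hx|H d Hsub d0 dH IH x Hx].
  have chi0 : int_hom_on H (fun=> 0) by move=> y z _ _; rewrite !subr0.
  have [xi xiH xix] := discrete_extend_int_hom 0 (ltnSn _)
    (fun h _ => submx1 h^T) Hsub r0 Hr chi0 Hx.
  exists xi; last by rewrite subr0 in xix.
  by move=> h /xiH; rewrite subr0.
have [|xi xiH xix] := IH (perp d x).
  by move=> Hpx; apply: Hx; exact: mem_perp_line Hpx.
exists (perp d xi); last by rewrite dotv_perpC.
by move=> h Hh; rewrite dotv_perpC; apply: xiH; exists h.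
Qed.

(** Modulo its lines [H] is discrete, and projecting off a line shortens vectors;
    so a short enough element projects to 0 once all lines are split off. *)
Lemma closed_subgroup_near0 H : closed H -> additive_subgroup H ->
  exists2 r, 0 < r & forall h, H h -> dotv h h < r -> has_line H h.
Proof.
move: H; apply: closed_subgroup_ind =>
    [H r Hsub r0 Hr|H d Hsub d0 dH [r r0 IH]].
  exists r => // h Hh hr t.
  suff -> : h = 0 by rewrite scaler0; exact: subgroup0.
  by apply/eqP/negP => /negP /(Hr _ Hh); rewrite leNgt hr.
exists r => // h Hh hr t; apply: (mem_perp_line Hsub dH).
have := IH (perp d h) (ex_intro2 _ _ h Hh erefl)
  (le_lt_trans (dotvv_perp_le _ _) hr) t.
by rewrite !perpE scalemxAr.
Qed.

End topology.

(** * Trigonometry *)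

Section trigonometry.
Context {R : realType}.
Implicit Types t s : R.

Lemma cosDz t (k : int) : cos (t + pi *+ 2 *~ k) = cos t.
Proof.
have cosDn s m : cos (s + pi *+ 2 *+ m) = cos s.
  by rewrite (periodicn (@cosD2pi R)).
case: k => m; first by rewrite -pmulrn cosDn.
by rewrite NegzE mulrNz -pmulrn -(cosDn _ m.+1) subrK.
Qed.

Lemma one_minus_cos t : 1 - cos t = 2 * sin (t / 2) ^+ 2.
Proof.
rewrite {1}(_ : t = (t / 2) *+ 2); last by rewrite -mulr_natr divfK.
rewrite cos_mulr2n cos2sin2; ring.
Qed.

(** Shift [t] by a multiple of [2 pi] to [s] with [0 <= s < 2 pi]; then
    [2 sin (s / 2) ^ 2 = 0], while the sine is positive on [(0, pi)]. *)
Lemma cos_eq1 t : cos t = 1 <-> t / (2 * pi) \is a Num.int.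
Proof.
have pi2 : 0 < 2 * pi :> R by rewrite mulr_gt0// pi_gt0.
split=> [ct|/intrP[k tk]]; last first.
  have -> : t = 0 + pi *+ 2 *~ k.
    by rewrite add0r -(mulrzl _ k) -tk -(mulr_natl pi) divfK// gt_eqF.
  by rewrite cosDz cos0.
rewrite intrEfloor; apply/eqP; set k := Num.floor _.
have /andP[k1 k2] := floor_itv (t / (2 * pi)); rewrite -/k in k1 k2.
rewrite ler_pdivlMr// in k1; rewrite ltr_pdivrMr// intrD mulrDl mul1r in k2.
pose s := t - k%:~R * (2 * pi).
have cs : cos s = 1.
  by rewrite -ct -(cosDz s k) -(mulr_natl pi) -(mulrzl _ k) subrK.
have /eqP : 2 * sin (s / 2) ^+ 2 = 0 by rewrite -one_minus_cos cs subrr.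
rewrite mulf_eq0 pnatr_eq0/= sqrf_eq0 => /eqP ss.
have s0 : s = 0.
  apply/eqP/negP => /negP s0.
  suff : 0 < sin (s / 2) by rewrite ss ltxx.
  have sge0 : 0 <= s by rewrite subr_ge0.
  have sgt0 : 0 < s by rewrite lt_def s0 sge0.
  apply: sin_gt0_pi; rewrite divr_gt0//=.
  by rewrite ltr_pdivrMr// mulrC /s ltrBlDl.
by apply: (mulIf (lt0r_neq0 pi2)); rewrite divfK ?gt_eqF//; apply/eqP;
  rewrite -subr_eq0 -oppr_eq0 opprB -/s s0.
Qed.

Lemma cos_eq1_sin t : cos t = 1 -> sin t = 0.
Proof. by move=> ct; apply/eqP; rewrite -norm_cos_eq1 ct normr1. Qed.

Lemma expi_eq1 t : expi t = 1 <-> t / (2 * pi) \is a Num.int.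
Proof.
rewrite -cos_eq1 /expi; split=> [/(congr1 (@complex.Re R))//|ct].
by rewrite ct cos_eq1_sin.
Qed.

Lemma normr_sin_le t : `|sin t| <= `|t|.
Proof.
wlog t0 : t / 0 < t.
  move=> h; have [t0|t0|->] := ltgtP t 0; last by rewrite sin0.
    by rewrite -normrN -sinN -(normrN t) h// oppr_gt0.
  exact: h.
have [|c _] := @MVT R sin cos 0 t t0 (fun x _ => is_derive_sin x).
  by apply: continuous_subspaceT; exact: continuous_sin.
rewrite sin0 !subr0 => ->; rewrite normrM ler_piMl//.
by rewrite ler_norml cos_geN1 cos_le1.
Qed.

Lemma one_minus_cos_le t : 1 - cos t <= t ^+ 2.
Proof.
rewrite one_minus_cos.
have h : sin (t / 2) ^+ 2 <= (t / 2) ^+ 2.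
  rewrite -(real_normK (num_real (sin _))) -(real_normK (num_real (t / 2))).
  by rewrite ler_sqr ?nnegrE// normr_sin_le.
have t2 := sqr_ge0 t; rewrite exprMn in h; move: h t2; set u := t ^+ 2.
by rewrite -[2^-1 ^+ 2]/(2^-1 * 2^-1 : R); lra.
Qed.

End trigonometry.

(** * Borel sets and Lévy measures *)

Section borel.
Context {R : realType} {n : nat}.
Local Notation T := (borelRn R n).

Lemma open_borel (A : set 'cV[R]_n) : open A -> measurable (A : set T).
Proof. by move=> oA; apply: sub_sigma_algebra. Qed.

Lemma closed_borel (A : set 'cV[R]_n) : closed A -> measurable (A : set T).
Proof.
move=> cA; rewrite -[A]setCK; apply: measurableC.
by apply: open_borel; exact: closed_openC.
Qed.

Lemma continuous_borel (f : 'cV[R]_n -> R) : continuous f ->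
  measurable_fun setT (f : T -> R).
Proof.
move=> /continuousP cf.
refine (@measurability _ _ T R setT f _ (RGenOpens.measurableE R) _).
move=> _ [_ [a [b ->] <-]]; rewrite setTI; apply: open_borel.
exact/cf/interval_open.
Qed.

Lemma dotvl_measurable (xi : 'cV[R]_n) :
  measurable_fun setT ((fun x => dotv x xi) : T -> R).
Proof. by apply: continuous_borel; exact: dotvl_continuous. Qed.

Lemma enorm_continuous : continuous (@enorm R n).
Proof.
move=> x; apply: (@continuous_comp _ _ _ (fun x => dotv x x) Num.sqrt).
  exact: dotvv_continuous.
exact: sqrt_continuous.
Qed.

Lemma enorm_measurable : measurable_fun setT (@enorm R n : T -> R).
Proof. by apply: continuous_borel; exact: enorm_continuous. Qed.

Lemma sqr_enorm (x : 'cV[R]_n) : enorm x ^+ 2 = dotv x x.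
Proof. by rewrite sqr_sqrtr// dotvv_ge0. Qed.

Lemma enorm_gt0 (x : 'cV[R]_n) : (0 < enorm x) = (x != 0).
Proof. by rewrite sqrtr_gt0 dotvv_gt0. Qed.

Lemma closed_set0v : closed [set 0 : 'cV[R]_n].
Proof.
have -> : [set 0 : 'cV[R]_n] = (fun x => dotv x x) @^-1` [set 0].
  apply/seteqP; split=> [_ ->|x /eqP]; first exact: dotv0l.
  by rewrite dotvv_eq0 => /eqP.
apply: ((continuous_closedP _).1 (@dotvv_continuous R n)); exact: closed_eq.
Qed.

Lemma measurable_punctured : measurable ([set~ (0 : 'cV[R]_n)] : set T).
Proof. by apply: measurableC; apply: closed_borel; exact: closed_set0v. Qed.

End borel.

Section levy_measures.
Context {R : realType} {n : nat}.
Local Notation T := (borelRn R n).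
Variable nu : {measure set T -> \bar R}.
Local Notation D := ([set~ (0 : 'cV[R]_n)] : set T).

(** Apart from 0, the complement of the support is covered by the null
    balls with rational centre and radius, of which there are countably many. *)
Lemma supp_conegligible : nu [set (0 : 'cV[R]_n)] = 0%E ->
  nu.-negligible (~` supp nu).
Proof.
move=> nu0.
pose B (k : nat) : set T := if unpickle k is Some (q, r)
  then ball (map_mx ratr (q : 'cV[rat]_n) : 'cV[R]_n) (ratr (r : rat))
  else set0.
pose F k : set T := if nu (B k) == 0%E then B k else set0.
have Bm k : measurable (B k).
  rewrite /B; case: unpickle => [[q r]|//]; apply: open_borel.
  exact: ball_open.
have Fneg k : nu.-negligible (F k).
  rewrite /F; case: ifPn => [/eqP B0|_]; last exact: negligible_set0.
  exact/negligibleP.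
apply: (negligibleS _ (negligibleU _ (negligible_bigcup Fneg))); last first.
  apply/(negligibleP _ _).2 : nu0; apply: closed_borel; exact: closed_set0v.
move=> x /= xN; have [->|x0] := eqVneq x 0; [by left|right].
have /existsNP[U /not_implyP[oU /not_implyP[Ux /negP nuU]]] :
    ~ (forall U : set 'cV[R]_n, open U -> U x -> (0 < nu U)%E).
  by move=> h; apply: xN.
have [e /= e0 eU] : exists2 e, 0 < e & ball x e `<=` U.
  by apply/nbhs_ballP; exact: open_nbhs_nbhs.
have e20 : 0 < e / 2 by rewrite divr_gt0.
have [r] := rat_in_itvoo e20; rewrite in_itv/= => /andP[r0 re].
have [q xq] : exists q : 'cV[rat]_n, ball (map_mx ratr q : 'cV[R]_n) (ratr r) x.
  have xr i : exists q : rat, `|x i 0 - ratr q| < ratr r.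
    have xr : x i 0 < x i 0 + ratr r by rewrite ltrDl.
    have [q] := rat_in_itvoo xr; rewrite in_itv/= => /andP[q1 q2].
    by exists q; rewrite ltr_norml; apply/andP; split; lra.
  have [q hq] := choice xr.
  exists (\col_i q i); split=> // i j; rewrite !mxE (ord1 j).
  by rewrite -ball_normE /ball_ /= distrC.
have BU : ball (map_mx ratr q : 'cV[R]_n) (ratr r) `<=` U.
  move=> y qy; apply: eU; rewrite [e]splitr.
  have := le_ball (ltW re) (ball_sym xq); have := le_ball (ltW re) qy.
  by move=> qy' xq'; exact: ball_triangle xq' qy'.
exists (pickle (q, r)) => //; rewrite /F /B pickleK ifT//.
rewrite -measure_le0; apply: le_trans (_ : _ <= nu U)%E _.
  apply: le_measure => //; rewrite inE; apply: open_borel => //.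
  exact: ball_open.
by rewrite leNgt.
Qed.


Hypothesis levy : levy_measure nu.

Let nu0 : nu [set (0 : 'cV[R]_n)] = 0%E.
Proof. by case: levy => -[]. Qed.

Let minsq (x : 'cV[R]_n) : R := Num.min (enorm x ^+ 2) 1.

Lemma integrable_minsq : nu.-integrable D (EFin \o minsq).
Proof.
have m : measurable_fun setT (minsq : T -> R).
  apply: measurable_minr; last exact: measurable_cst.
  by apply: measurable_funX; exact: enorm_measurable.
apply/integrableP; split.
  by apply/measurable_EFinP; exact: measurable_funTS.
case: levy => _; apply: le_lt_trans.
rewrite le_eqVlt; apply/orP; left; apply/eqP.
apply: eq_integral => x _; congr EFin.
by rewrite ger0_norm// le_min sqr_ge0 ler01.
Qed.

(** [1 - cos] is at most 2, and quadratic near 0. *)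
Lemma one_minus_cos_integrable (xi : 'cV[R]_n) :
  nu.-integrable D (EFin \o (fun x => 1 - cos (dotv x xi))).
Proof.
pose C := 2 + dotv xi xi.
have C0 : 0 <= C by rewrite addr_ge0 ?dotvv_ge0.
apply: (@le_integrable _ _ _ nu D _ _ (fun x => C%:E * (minsq x)%:E)%E) => //.
- exact: measurable_punctured.
- apply/measurable_EFinP; apply: measurable_funTS; apply: measurable_funB => //.
  apply: measurableT_comp; last exact: dotvl_measurable.
  by apply: continuous_measurable_fun; exact: continuous_cos.
- move=> x _; suff : `|1 - cos (dotv x xi)| <= `|C * minsq x| by [].
  have c1 : 0 <= 1 - cos (dotv x xi) by rewrite subr_ge0 cos_le1.
  rewrite ger0_norm//.
  apply: le_trans (ler_norm _); rewrite /minsq sqr_enorm /C.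
  have c2 := one_minus_cos_le (dotv x xi); have c3 := sqr_dotv_le x xi.
  have c4 := cos_geN1 (dotv x xi).
  have x0 := dotvv_ge0 x; have xi0 := dotvv_ge0 xi.
  rewrite minEle; case: ifPn => _; last by lra.
  have := mulr_ge0 x0 xi0; lra.
- apply: integrableZl; [exact: measurable_punctured|exact: integrable_minsq].
Qed.

(** The integrand is nonnegative, so it vanishes almost everywhere when the
    integral does; as it is continuous, it then vanishes on the support. *)
Lemma int_one_minus_cos_eq0 (xi : 'cV[R]_n) :
  \int[nu]_(x in D) (1 - cos (dotv x xi)) = 0 <->
  forall x, supp nu x -> cos (dotv x xi) = 1.
Proof.
have cI := one_minus_cos_integrable xi.
have cm : measurable_fun D (EFin \o (fun x : T => 1 - cos (dotv x xi))).
  by case/integrableP : cI.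
have mD := @measurable_punctured R n.
split=> [|h]; last first.
  rewrite /Rintegral (@ae_eq_integral _ _ _ nu D (cst 0%E)) ?integral0//.
  have := supp_conegligible nu0; apply: negligibleS => x /= /not_implyP[_ hx].
  move=> xs.
  by apply: hx; rewrite h// subrr.
move=> h0; have := congr1 (@EFin R) h0; rewrite /Rintegral.
rewrite fineK ?integrable_fin_num// => int0 x [x0 xs].
pose U : set T := D `&` [set y | cos (dotv y xi) != 1].
have Uo : open (U : set 'cV[R]_n).
  apply: openI; first by apply: closed_openC; exact: closed_set0v.
  have -> : [set y : 'cV[R]_n | cos (dotv y xi) != 1] =
      ~` ((fun y => cos (dotv y xi)) @^-1` [set 1]).
    by apply/seteqP; split=> y /eqP.
  apply: closed_openC; apply: (continuous_closedP _).1; last exact: closed_eq.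
  move=> y; apply: (@continuous_comp _ _ _ (fun x => dotv x xi) cos).
    exact: dotvl_continuous.
  exact: continuous_cos.
apply/eqP/negPn/negP => cx.
have := xs _ Uo (conj (elimN eqP x0) cx).
rewrite lt0e => /andP[/eqP Un0 _]; apply: Un0.
apply/negligibleP; first exact: open_borel.
have /ae_eq_integral_abs :
    (\int[nu]_(x in D) `|(1 - cos (dotv x xi))%:E| = 0)%E.
  apply: etrans int0; apply: eq_integral => y _.
  by rewrite abse_EFin ger0_norm// subr_ge0 cos_le1.
move=> /(_ mD cm); apply: negligibleS => y [Dy /= cy] /= /(_ Dy) [] /eqP.
by rewrite subr_eq0 eq_sym (negPf cy).
Qed.

End levy_measures.

(** * Annihilators of points *)

Section annihilators.
Context {R : realType} {n : nat}.
Implicit Types (x y z xi : 'cV[R]_n) (A : set 'cV[R]_n).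

Lemma closure_additive_subgroup A :
  additive_subgroup A -> additive_subgroup (closure A).
Proof.
move=> Asub; split; first by apply: subset_closure; exact: subgroup0.
move=> x y Ax Ay B /nbhs_ballP[e /= e0 eB].
have e20 : 0 < e / 2 by rewrite divr_gt0.
have [a [Aa]] := Ax _ (nbhsx_ballx x _ e20); rewrite -ball_normE /= => xa.
have [c [Ac]] := Ay _ (nbhsx_ballx y _ e20); rewrite -ball_normE /= => yc.
exists (a - c); split; first exact: subgroupB.
apply: eB; rewrite -ball_normE /=.
have -> : x - y - (a - c) = (x - a) - (y - c).
  by rewrite !opprB addrACA [RHS]addrACA (addrC (- y)).
by rewrite [e]splitr; apply: le_lt_trans (ler_normB _ _) _; exact: ltrD.
Qed.

Definition annihilated xi : set 'cV[R]_n := [set x | cos (dotv x xi) = 1].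

Lemma annihilatedP xi x :
  annihilated xi x <-> dotv x xi / (2 * pi) \is a Num.int.
Proof. exact: cos_eq1. Qed.

Lemma closed_annihilated xi : closed (annihilated xi).
Proof.
apply: ((continuous_closedP (fun y => cos (dotv y xi))).1 _ [set 1]);
  last exact: closed_eq.
move=> y; apply: (@continuous_comp _ _ _ (fun x => dotv x xi) cos).
  exact: dotvl_continuous.
exact: continuous_cos.
Qed.

Lemma annihilated_subgroup xi : additive_subgroup (annihilated xi).
Proof.
split=> [|x y /annihilatedP xP /annihilatedP yP]; apply/annihilatedP.
  by rewrite dotv0l mul0r.
by rewrite dotvBl mulrBl; exact: rpredB.
Qed.

Lemma line_int_eq0 (a : R) : (forall t, t * a \is a Num.int) -> a = 0.
Proof.
move=> h; apply/eqP/negP => /negP a0; have := h (2^-1 / a).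
by rewrite divfK// (negPf half_not_int).
Qed.

Lemma annihilated_line xi x : has_line (annihilated xi) x -> dotv x xi = 0.
Proof.
move=> h; have pi0 : 2 * pi != 0 :> R by rewrite mulf_neq0// gt_eqF// pi_gt0.
have : dotv x xi / (2 * pi) = 0.
  apply: line_int_eq0 => t; rewrite mulrA -dotvZl; exact/annihilatedP.
by move/eqP; rewrite mulf_eq0 invr_eq0 (negPf pi0) orbF => /eqP.
Qed.

Lemma set_add_subgroup A B : additive_subgroup A -> additive_subgroup B ->
  additive_subgroup (set_add A B).
Proof.
move=> As Bs; split.
  by exists 0; [exact: subgroup0|exists 0; [exact: subgroup0|rewrite addr0]].
move=> _ _ [x Ax [y By <-]] [x' Ax' [y' By' <-]].
exists (x - x'); first exact: subgroupB.
by exists (y - y'); [exact: subgroupB|rewrite addrACA -opprD].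
Qed.

Lemma Wspan_subgroup (Sigma : 'M[R]_n) v : additive_subgroup (Wspan Sigma v).
Proof. by split=> [|x y]; [exact: mem0v|exact: rpredB]. Qed.

Lemma Wspan_line (Sigma : 'M[R]_n) v x : Wspan Sigma v x ->
  has_line (Wspan Sigma v) x.
Proof. by move=> Wx t; exact: memvZ. Qed.

Lemma dotv_col (Sigma : 'M[R]_n) j xi :
  Sigma^T = Sigma -> dotv (col j Sigma) xi = (Sigma *m xi) j 0.
Proof.
by move=> SS; rewrite -{2}SS mxE; apply: eq_bigr => i _; rewrite !mxE.
Qed.

(** By symmetry of [Sigma], [Sigma *m xi] lists the products of [xi] with the
    columns. *)
Lemma Wspan_orthogonal (Sigma : 'M[R]_n) v xi : Sigma^T = Sigma ->
  (forall x, Wspan Sigma v x -> dotv x xi = 0) <->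
  Sigma *m xi = 0 /\ dotv v xi = 0.
Proof.
move=> SS; split=> [h|[Sxi vxi] x].
  split; last by apply: h; apply: memv_span; rewrite mem_rcons mem_head.
  apply/colP => j; rewrite -dotv_col// mxE; apply: h; apply: memv_span.
  rewrite mem_rcons in_cons; apply/orP; right.
  by apply/mapP; exists j; rewrite ?mem_enum.
rewrite /Wspan /= => /(@coord_span _ _ _ (in_tuple _)) ->.
rewrite (big_morph (fun x => dotv x xi) (fun x y => dotvDl x y xi) (dotv0l xi)).
rewrite big1// => i _; rewrite dotvZl.
have : (in_tuple (rcons [seq col j Sigma | j : 'I_n] v))`_i
    \in rcons [seq col j Sigma | j : 'I_n] v by exact: mem_nth.
rewrite mem_rcons in_cons => /orP[/eqP ->|/mapP[j _ ->]].
  by rewrite vxi mulr0.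
by rewrite dotv_col// Sxi mxE mulr0.
Qed.

End annihilators.

(** * Zeros of the exponent *)

Section zero_set.
Context {R : realType} {n : nat}.
Local Notation T := (borelRn R n).
Variable nu : {measure set T -> \bar R}.
Local Notation D := ([set~ (0 : 'cV[R]_n)] : set T).

Lemma Gnu_subgroup : additive_subgroup (Gnu nu).
Proof.
split=> [M [Ms _]|x y Gx Gy M [Ms sM]]; first exact: subgroup0.
by apply: subgroupB => //; [exact: Gx|exact: Gy].
Qed.

Lemma supp_Gnu : supp nu `<=` Gnu nu.
Proof. by move=> x sx M [_]; exact. Qed.

Lemma closure_Gnu_sub (M : set 'cV[R]_n) : closed M -> additive_subgroup M ->
  supp nu `<=` M -> closure (Gnu nu) `<=` M.
Proof.
move=> cM Ms sM; rewrite ((closure_id M).1 cM); apply: closure_subset.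
by move=> x; apply; split.
Qed.

Lemma closure_Gnu_subgroup : additive_subgroup (closure (Gnu nu)).
Proof. exact/closure_additive_subgroup/Gnu_subgroup. Qed.

Lemma Vnu_closed : closed (Vnu nu).
Proof.
have -> : Vnu nu =
    \bigcap_(t in @setT R)
      ((fun x : 'cV[R]_n => t *: x) @^-1` closure (Gnu nu)).
  apply/seteqP; split=> [x [_ h] t _|x h]; first exact: h.
  by split=> [|t]; [rewrite -[x]scale1r|]; exact: h.
apply: closed_bigI => t _; apply: (continuous_closedP _).1.
  exact: scaler_continuous.
exact: closed_closure.
Qed.

Definition small_off_Vnu : set T := [set y : 'cV[R]_n | enorm y < 1] `\` Vnu nu.

Lemma measurable_small_off_Vnu : measurable small_off_Vnu.
Proof.
apply: measurableD; last by apply: closed_borel; exact: Vnu_closed.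
apply: open_borel.
have -> : [set y : 'cV[R]_n | enorm y < 1] =
  @enorm R n @^-1` [set z | z < 1] by [].
apply: ((continuousP _).1 (@enorm_continuous R n)); exact: open_lt.
Qed.

Hypothesis levy : levy_measure nu.

Let supp_ae : nu.-negligible (~` supp nu).
Proof. by apply: supp_conegligible; case: levy => -[]. Qed.

(** Off [Vnu], the support keeps away from the origin, so that the coordinates
    are dominated by the integrable function [min (|x|^2, 1)]. *)
Lemma coord_integrable (i : 'I_n) :
  nu.-integrable small_off_Vnu (EFin \o (fun y : 'cV[R]_n => y i 0)).
Proof.
have mA := measurable_small_off_Vnu.
have mi : measurable_fun setT ((fun y : 'cV[R]_n => y i 0) : T -> R).
  by apply: continuous_borel => y; exact: coord_continuous.
have [r r0 near0] := closed_subgroup_near0 (@closed_closure _ (Gnu nu))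
  closure_Gnu_subgroup.
have [N [mN N0 suppN]] := supp_ae.
have mAN : measurable (small_off_Vnu `\` N) by exact: measurableD.
apply/(negligible_integrable mN mA _ N0).
  by apply/measurable_EFinP; exact: measurable_funTS.
have ANs y : (small_off_Vnu `\` N) y -> supp nu y.
  by move=> [_ Ny]; apply: contrapT => sy; apply: Ny; exact: suppN.
pose C := 1 + r^-1.
apply: (@le_integrable _ _ _ nu _ mAN _
  (fun x : T => C%:E * (Num.min (enorm x ^+ 2) 1)%:E)%E).
- by apply/measurable_EFinP; exact: measurable_funTS.
- move=> y yA; have sy := ANs _ yA; have [[y1 yV] _] := yA.
  suff : `|(y : 'cV[R]_n) i 0| <= `|C * Num.min (enorm y ^+ 2) 1| by [].
  apply: le_trans (ler_norm _).
  have Gy : closure (Gnu nu) y by apply: subset_closure; exact: supp_Gnu.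
  have ry : r <= enorm y ^+ 2.
    rewrite sqr_enorm leNgt; apply/negP => yr; apply: yV; split=> //.
    exact: near0.
  have yi : `|(y : 'cV[R]_n) i 0| <= 1.
    have := norm_le_enorm y; move=> /(mx_norm_leP _ (sqrtr_ge0 _))/(_ i 0).
    by move/le_trans; apply; exact: ltW.
  apply: le_trans yi _; have ri : 0 < r^-1 by rewrite invr_gt0.
  rewrite minEle; case: ifPn => _; last by rewrite mulr1 lerDl ltW.
  apply: le_trans (ler_wpM2l _ ry); last by rewrite addr_ge0// ltW.
  by rewrite mulrDl mul1r mulVf ?gt_eqF// lerDr ltW.
- apply: integrableZl => //.
  apply: integrableS (integrable_minsq levy) => //.
    exact: measurable_punctured.
  by move=> y /ANs[/eqP].
Qed.

Lemma dotv_cnu (xi : 'cV[R]_n) :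
  dotv (cnu nu) xi = - \int[nu]_(y in small_off_Vnu) dotv y xi.
Proof.
have mA := measurable_small_off_Vnu.
rewrite /Rintegral.
under eq_integral do rewrite /dotv -sumEFin.
rewrite integral_sum//; last first.
  move=> i; under eq_fun do rewrite mulrC EFinM.
  by apply: integrableZl => //; exact: coord_integrable.
rewrite (eq_bigr (fun i =>
    ((\int[nu]_(y in small_off_Vnu) y i 0) * xi i 0)%:E)); last first.
  move=> i _; under eq_integral do rewrite mulrC EFinM.
  rewrite integralZl//; last exact: coord_integrable.
  rewrite mulrC EFinM /Rintegral fineK//.
  by apply: integrable_fin_num => //; exact: coord_integrable.
rewrite sumEFin /= -sumrN; apply: eq_bigr => i _.
by rewrite mxE mulNr.
Qed.

(** Almost every [x] is in the support, where [sin (x . xi) = 0]; and points of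
    [Vnu nu] contribute nothing, as [xi] is orthogonal to the lines of
    [closure (Gnu nu)]. *)
Lemma imaginary_integral (xi : 'cV[R]_n) :
  (forall x, supp nu x -> cos (dotv x xi) = 1) ->
  \int[nu]_(x in D) (- sin (dotv x xi)
    + dotv x xi * \1_(`]0, 1[%classic : set R) (enorm x))
  = - dotv (cnu nu) xi.
Proof.
move=> suppxi; rewrite dotv_cnu opprK.
have mA := measurable_small_off_Vnu.
have mdot := @dotvl_measurable R n xi.
rewrite [LHS]Rintegral_mkcond [RHS]Rintegral_mkcond /Rintegral; congr fine.
apply: ae_eq_integral => //.
- apply/measurable_EFinP/measurable_restrict => //.
    exact: measurable_punctured.
  apply: measurable_funTS; apply: measurable_funD.
    apply: measurable_funN; apply: measurableT_comp mdot.
    by apply: continuous_measurable_fun; exact: continuous_sin.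
  apply: measurable_funM => //.
  apply: measurableT_comp; last exact: enorm_measurable.
  exact: measurable_indic.
- apply/measurable_EFinP/measurable_restrict => //.
  exact: measurable_funTS.
apply: negligibleS supp_ae => x /= /not_implyP[_ hx] sx; apply: hx; congr EFin.
have x0 : x != 0 :> 'cV[R]_n by case: sx.
rewrite !patchE mem_set; last exact/eqP.
rewrite (cos_eq1_sin (suppxi _ sx)) oppr0 add0r indicE.
case: ifPn => [/set_mem[x1 _]|/negP xA].
  by rewrite mem_set ?mulr1//= in_itv/= enorm_gt0 x0.
have [x1|x1] := ltP (enorm x) 1; last first.
  rewrite memNset ?mulr0//= in_itv/= => /andP[_].
  by rewrite ltNge x1.
suff -> : dotv x xi = 0 by rewrite mul0r.
apply: annihilated_line => t.
have [_ /(_ t)] : Vnu nu x.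
  by apply: contrapT => xV; apply: xA; exact: mem_set.
apply: closure_Gnu_sub => //; first exact: closed_annihilated.
exact: annihilated_subgroup.
Qed.

Local Open Scope complex_scope.

Lemma levy_khintchineE b (Q : 'M[R]_n) xi : levy_khintchine b Q nu xi =
  (2^-1 * dotv (Q *m xi) xi + \int[nu]_(x in D) (1 - cos (dotv x xi)))
  +i* (- dotv b xi + \int[nu]_(x in D) (- sin (dotv x xi)
    + dotv x xi * \1_(`]0, 1[%classic : set R) (enorm x))).
Proof.
rewrite /levy_khintchine /Cintegral.
have -> : (fun x : 'cV[R]_n => complex.Re (1 - expi (dotv x xi)
    + 'i * (dotv x xi * \1_(`]0, 1[%classic : set R) (enorm x))%:C))
    = (fun x => 1 - cos (dotv x xi)).
  by apply/funext => x; rewrite /expi /=; ring.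
have -> : (fun x : 'cV[R]_n => complex.Im (1 - expi (dotv x xi)
    + 'i * (dotv x xi * \1_(`]0, 1[%classic : set R) (enorm x))%:C))
    = (fun x => - sin (dotv x xi)
      + dotv x xi * \1_(`]0, 1[%classic : set R) (enorm x)).
  by apply/funext => x; rewrite /expi /=; ring.
by apply/eqP; rewrite eq_complex /=; apply/andP; split; apply/eqP; ring.
Qed.

(** The real part of the exponent is a sum of two nonnegative terms, so both
    vanish; on the resulting set the imaginary part is linear. *)
Lemma levy_khintchine_eq0 b (Q Sigma : 'M[R]_n) xi : psd_sqrt_of Q Sigma ->
  levy_khintchine b Q nu xi = 0 <->
  [/\ forall x, supp nu x -> cos (dotv x xi) = 1,
      Sigma *m xi = 0 & dotv (b + cnu nu) xi = 0].
Proof.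
move=> [[SS _] SQ]; rewrite levy_khintchineE.
have -> : dotv (Q *m xi) xi = dotv (Sigma *m xi) (Sigma *m xi).
  by rewrite -SQ -mulmxA dotv_mulmxl SS.
split=> [/eqP|[suppxi Sxi bc]]; last first.
  rewrite (int_one_minus_cos_eq0 levy xi).2// imaginary_integral//.
  by rewrite Sxi dotv0l mulr0 addr0 -opprD -dotvDl bc oppr0.
rewrite eq_complex /= => /andP[/eqP re /eqP im].
have q0 := dotvv_ge0 (Sigma *m xi).
have c0 : 0 <= \int[nu]_(x in D) (1 - cos (dotv x xi)).
  by apply: Rintegral_ge0 => x _; rewrite subr_ge0 cos_le1.
have suppxi : forall x, supp nu x -> cos (dotv x xi) = 1.
  apply: (int_one_minus_cos_eq0 levy xi).1; lra.
split=> //.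
  by apply/eqP; rewrite -dotvv_eq0; apply/eqP; lra.
move: im; rewrite imaginary_integral// dotvDl -opprD => /eqP.
by rewrite oppr_eq0 => /eqP.
Qed.

End zero_set.

Theorem corollary2 (R : realType) (n : nat) (b : 'cV[R]_n) (Q Sigma : 'M[R]_n)
    (nu : {measure set (borelRn R n) -> \bar R}) (psi : 'cV[R]_n -> R[i]) :
  char_exponent b Q nu psi ->
  psd_sqrt_of Q Sigma ->
  orth_subgroup (zero_set psi)
  = closure (set_add (Gnu nu) (Wspan Sigma (b + cnu nu))).
Proof.
move=> [[_ levy] ->] SQ; have [[SS _] _] := SQ.
set W := Wspan _ _; set H := closure _.
have Gs := Gnu_subgroup nu.
have Ws : additive_subgroup W := Wspan_subgroup _ _.
have Hs : additive_subgroup H.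
  by apply: closure_additive_subgroup; exact: set_add_subgroup.
have GH x : Gnu nu x -> H x.
  move=> Gx; apply: subset_closure; exists x => //.
  by exists 0; [exact: subgroup0|rewrite addr0].
have WH x : W x -> H x.
  move=> Wx; apply: subset_closure; exists 0; first exact: subgroup0.
  by exists x => //; rewrite add0r.
apply/seteqP; split=> [x xo|x Hx xi].
  apply: contrapT => Hx.
  have [eta etaH] := closed_subgroup_separation (@closed_closure _ _) Hs Hx.
  have pi0 : 2 * pi != 0 :> R by rewrite mulf_neq0// gt_eqF// pi_gt0.
  have e2 y : dotv y ((2 * pi) *: eta) / (2 * pi) = dotv eta y.
    by rewrite dotvZr mulrC mulKf// dotvC.
  apply/negP; rewrite negbK -e2; apply/expi_eq1/xo.
  have ann y : H y -> annihilated ((2 * pi) *: eta) y.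
    by move=> Hy; apply/annihilatedP; rewrite e2; exact: etaH.
  apply/(levy_khintchine_eq0 levy b _ SQ).
  have [Sxi bxi] : Sigma *m ((2 * pi) *: eta) = 0 /\
      dotv (b + cnu nu) ((2 * pi) *: eta) = 0.
    apply/(Wspan_orthogonal _ _ SS) => y Wy; apply: annihilated_line => t.
    exact/ann/WH/Wspan_line.
  by split=> // y sy; apply: ann; apply: GH; exact: supp_Gnu.
move=> /(levy_khintchine_eq0 levy b _ SQ)[suppxi Sxi bxi].
apply/expi_eq1/cos_eq1; move: x Hx.
have annC := @closed_annihilated R n xi; have annS := annihilated_subgroup xi.
rewrite -/(annihilated xi) /H; change (H `<=` annihilated xi).
rewrite ((closure_id _).1 annC); apply: closure_subset => _ [x Gx [y Wy <-]].
apply: subgroupD => //.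
  by apply: (@closure_Gnu_sub _ _ nu) => //; exact: subset_closure.
rewrite /annihilated /= (_ : dotv y xi = 0) ?cos0//.
by apply: (Wspan_orthogonal _ _ SS).2 Wy.
Qed.
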